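(* The complementary prism $K_n\overline{K_n}$ of the complete graph $K_n$ on $n$ vertices admits perfect pair state transfer with respect to the Laplacian matrix if and only if $n=2$.
   Context: The complementary prism $G\overline{G}$ of a graph $G$ is obtained from the disjoint union of $G$ and its complement $\overline{G}$ (vertices relabelled $a'$ for $a\in V(G)$) by adding an edge between each vertex $a$ of $G$ and its copy $a'$ in $\overline{G}$. The Laplacian matrix is $L=D-A$, with $A$ the adjacency matrix and $D$ the diagonal degree matrix. For a real symmetric matrix $M$ associated with a graph, $U_M(t)=\exp(itM)$. There is perfect state transfer between two linearly independent real unit vectors $\mathbf{u},\mathbf{v}$ with respect to $M$ if there exist $\tau>0$ and $\gamma\in\mathbb{C}$ with $|\gamma|=1$ such that $U_M(\tau)\mathbf{u}=\gamma\mathbf{v}$. A pair state is a vector $\frac{1}{\sqrt2}(\mathbf{e}_x-\mathbf{e}_y)$ with $x\ne y$ vertices of the graph, where $\mathbf{e}_x$ is the characteristic vector of $x$. A graph admits perfect pair state transfer if there is perfect state transfer between some two (linearly independent) pair states. *)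

(* Defs.v *)
From HB Require Import structures.
From mathcomp Require Import all_boot all_order all_algebra.
From mathcomp Require Import complex.
From mathcomp Require Import all_classical all_reals all_analysis.

Set Implicit Arguments.
Unset Strict Implicit.
Unset Printing Implicit Defensive.

Import Order.TTheory GRing.Theory Num.Theory.
Import numFieldNormedType.Exports.

Local Open Scope ring_scope.
Local Open Scope classical_set_scope.
Local Open Scope complex_scope.

Record sgraph := SGraph {
  vertex :> finType;
  adj : rel vertex;
  adj_sym : symmetric adj;
  adj_irr : irreflexive adj
}.

Section Graphs.

Lemma complete_sym (n : nat) : symmetric (fun x y : 'I_n => x != y).
Proof. by move=> x y; rewrite eq_sym. Qed.

Lemma complete_irr (n : nat) : irreflexive (fun x y : 'I_n => x != y).
Proof. by move=> x; rewrite eqxx. Qed.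

Definition complete (n : nat) : sgraph :=
  SGraph (@complete_sym n) (@complete_irr n).

Variable G : sgraph.

Definition compl_adj : rel G := fun x y => (x != y) && ~~ adj x y.

Lemma compl_sym : symmetric compl_adj.
Proof. by move=> x y; rewrite /compl_adj eq_sym adj_sym. Qed.

Lemma compl_irr : irreflexive compl_adj.
Proof. by move=> x; rewrite /compl_adj eqxx. Qed.

Definition compl : sgraph := SGraph compl_sym compl_irr.

(* [inl a] is the vertex a of G and [inr a] is its copy a' in the complement. *)
Definition cprism_adj : rel (G + compl)%type := fun p q =>
  match p, q with
  | inl a, inl b => @adj G a b
  | inr a, inr b => @adj compl a b
  | inl a, inr b => a == b
  | inr a, inl b => a == b
  end.

Lemma cprism_sym : symmetric cprism_adj.
Proof.
by case=> a [] b; rewrite /cprism_adj ?[a == b]eq_sym // adj_sym.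
Qed.

Lemma cprism_irr : irreflexive cprism_adj.
Proof. by case=> a; rewrite /cprism_adj adj_irr. Qed.

Definition cprism : sgraph := SGraph cprism_sym cprism_irr.

End Graphs.

(* Rows and columns are indexed by 'I_#|G| through the enumeration of the
   vertices of G. *)
Section GraphMatrices.
Variables (K : pzRingType) (G : sgraph).

Definition adjmx : 'M[K]_#|G| :=
  \matrix_(i, j) (adj (enum_val i) (enum_val j))%:R.

Definition degmx : 'M[K]_#|G| :=
  diag_mx (\row_i #|[set y : G | adj (enum_val i) y]%SET|%:R).

Definition laplacian : 'M[K]_#|G| := degmx - adjmx.

Definition charvec (x : G) : 'cV[K]_#|G| := delta_mx (enum_rank x) 0.

End GraphMatrices.

Section StateTransfer.
Variables (R : realType) (n : nat).

(* The series converges for every A, so [lim] never takes its default value. *)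
Definition mxexp (A : 'M[R[i]]_n) : 'M[R[i]]_n :=
  lim (series (fun k : nat => (k`!%:R)^-1 *: A ^+ k) @ \oo).

Definition transition (M : 'M[R]_n) (t : R) : 'M[R[i]]_n :=
  mxexp (('i%C * t%:C) *: map_mx (real_complex R) M).

Definition unit_vector (u : 'cV[R]_n) : Prop := \sum_i u i 0 ^+ 2 = 1.

Definition perfect_state_transfer (M : 'M[R]_n) (u v : 'cV[R]_n) : Prop :=
  [/\ unit_vector u, unit_vector v, free [:: u; v] &
      exists (tau : R) (gamma : R[i]),
        [/\ 0 < tau, `|gamma| = 1 &
            transition M tau *m map_mx (real_complex R) u
            = gamma *: map_mx (real_complex R) v]].

End StateTransfer.

Section PairStates.
Variables (R : realType) (G : sgraph).

Definition pair_state (x y : G) : 'cV[R]_#|G| :=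
  (Num.sqrt 2)^-1 *: (charvec R x - charvec R y).

Definition perfect_pair_state_transfer (M : 'M[R]_#|G|) : Prop :=
  exists x y z w : G,
    [/\ x != y, z != w &
        perfect_state_transfer M (pair_state x y) (pair_state z w)].

End PairStates.

(* Main.v *)
Require Import Defs.
From mathcomp Require Import all_boot all_order all_algebra.
From mathcomp Require Import complex spectral ring zify.
From mathcomp Require Import all_classical all_reals all_analysis.

(** Write [u . v] for the dot product.  If [U(tau) u = gamma v], and [w] is a
    real eigenvector of the Laplacian with eigenvalue [a], then pairing with
    [w] gives [exp(i a tau) (w . u) = gamma (w . v)], where both dot products
    are real and both scalars have modulus 1.  Hence
    [w . v = eps (w . u)] with a sign [eps] that depends only on the eigenvalue
    ([pst_eigenspace_sign]).

    The complementary prism of [K_n] consists of a clique and of pendant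
    vertices, one for each vertex of the clique.  If [h] is a function on the
    clique with sum 0, then [h] on the clique and [k h] on the pendant vertices
    form an eigenvector exactly when [k^2 = n k + 1] ([eigen_zero_sum]).  The
    roots of this equation are irrational for [n > 0], because [n^2 + 4] lies
    strictly between [n^2] and [(n+2)^2] and is not [(n+1)^2].  Let [u] and [v]
    be pair states, scaled to have integer entries, and put [g = v - eps u].
    Taking [h = e_i - e_j], orthogonality of [g] to the eigenvector is a relation
    [a + k b = 0] between integers, so [a = b = 0]: the vector [g] is constant on
    the clique and constant on the pendant vertices ([pst_layers]).  Its entries
    sum to 0, and it vanishes outside four vertices.  For [n >= 3] there are
    at least six vertices, so one of the two constants is 0, hence both are, and
    [v = eps u] contradicts linear independence ([no_pst_order_ge3]).  For
    [n = 1] there are only two vertices, and every two pair states are equal or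
    opposite.

    For [n = 2] the prism is a path with four vertices, and the pair state
    on one of its end edges is half the sum of an eigenvector with eigenvalue 2 and
    of a vector in the sum of the eigenspaces for [2 + sqrt 2] and [2 - sqrt 2].
    At time [pi / sqrt 2] the second part is multiplied by minus the phase of
    the first, which produces the pair state on the other end edge
    ([pst_order2]).

    The matrix exponential is computed by diagonalising the real symmetric
    matrix in a unitary basis: the exponential series then reduces
    to the series of [exp(i x)] for real [x] ([cvg_expi], [transition_diag]). *)

Set Implicit Arguments.
Unset Strict Implicit.
Unset Printing Implicit Defensive.

Import Order.TTheory GRing.Theory Num.Theory.
Import numFieldNormedType.Exports.

Local Open Scope ring_scope.
Local Open Scope classical_set_scope.
Local Open Scope complex_scope.

(** * The exponential series of a diagonalisable matrix *)

Lemma cvg_sum_seq (K : numFieldType) (V : normedModType K) (I : Type)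
    (r : seq I) (f : I -> nat -> V) (l : I -> V) :
  (forall i, f i @ \oo --> l i) ->
  (fun k => \sum_(i <- r) f i k) @ \oo --> \sum_(i <- r) l i.
Proof.
move=> fl; elim: r => [|i r IH].
  rewrite big_nil; under eq_fun do rewrite big_nil; exact: cvg_cst.
rewrite big_cons; under eq_fun do rewrite big_cons; exact: cvgD.
Qed.

(** This form isolates the eigenvalues as scalar coefficients of matrices that
    do not depend on them, so that limits can be taken coefficientwise. *)
Lemma diag_conj_sum (K : fieldType) n (P : 'M[K]_n) (d : 'rV[K]_n) :
  invmx P *m diag_mx d *m P = \sum_j d 0 j *: (col j (invmx P) *m row j P).
Proof.
apply/matrixP => i j; rewrite mxE summxE; apply: eq_bigr => k _.
by rewrite mul_mx_diag !mxE big_ord1 !mxE mulrAC mulrC.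
Qed.

Lemma diag_conj_exp (K : fieldType) n (P : 'M[K]_n) (d : 'rV[K]_n) k :
  P \in unitmx ->
  (invmx P *m diag_mx d *m P) ^+ k =
  invmx P *m diag_mx (map_mx (fun x => x ^+ k) d) *m P.
Proof.
move=> uP; elim: k => [|k IH].
  rewrite expr0; have -> : map_mx (fun x => x ^+ 0) d = const_mx 1.
    by apply/matrixP => i j; rewrite !mxE expr0.
  by rewrite diag_const_mx mulmx1 mulVmx.
rewrite exprS IH -[_ * _]/(_ *m _) !mulmxA mulmxK //; congr (_ *m _).
rewrite -mulmxA mulmx_diag; congr (_ *m diag_mx _).
by apply/matrixP => i j; rewrite !mxE ord1 exprS.
Qed.

Lemma scale_diag_conj (K : comPzRingType) n (A B : 'M[K]_n) (d : 'rV[K]_n) c :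
  c *: (A *m diag_mx d *m B) = A *m diag_mx (c *: d) *m B.
Proof. by rewrite linearZ -scalemxAr scalemxAl. Qed.

Lemma cvg_exp_series_diag (K : numFieldType) n (P : 'M[K]_n) (d e : 'rV[K]_n) :
  P \in unitmx ->
  (forall j,
    series (fun k => (k`!%:R)^-1 * d 0 j ^+ k) @ \oo --> (e 0 j : K^o)) ->
  series (fun k => (k`!%:R)^-1 *: (invmx P *m diag_mx d *m P) ^+ k) @ \oo -->
    invmx P *m diag_mx e *m P.
Proof.
move=> uP de; rewrite [in X in _ --> X]diag_conj_sum.
set S := series _; have -> : S =
  (fun m => \sum_j series (fun k => (k`!%:R)^-1 * d 0 j ^+ k) m *:
                   (col j (invmx P) *m row j P)).
  apply/funext => m; rewrite /S /series /=.
  under [RHS]eq_bigr do rewrite scaler_suml.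
  rewrite exchange_big /=; apply: eq_bigr => k _.
  rewrite diag_conj_exp // diag_conj_sum scaler_sumr; apply: eq_bigr => j _.
  by rewrite scalerA mxE.
by apply: cvg_sum_seq => j; apply: cvgZr_tmp; apply: de.
Qed.

(** * The complex exponential on the imaginary axis *)

Definition expi (R : realType) (x : R) : R[i] := cos x +i* sin x.

Lemma expiD (R : realType) (x y : R) : expi (x + y) = expi x * expi y.
Proof. by rewrite /expi cosD sinD; simpc; congr (_ +i* _); rewrite addrC. Qed.

Lemma normr_expi (R : realType) (x : R) : `|expi x| = 1.
Proof. by rewrite normc_def /= cos2Dsin2 sqrtr1. Qed.

(** The real and imaginary parts of the [k]-th term are the [k]-th terms of the
    series that define the cosine and the sine. *)
Lemma cvg_expi (R : realType) (x : R) :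
  series (fun k => (k`!%:R)^-1 * ('i%C * x%:C) ^+ k : R[i]^o) @ \oo -->
    (expi x : R[i]^o).
Proof.
have E k : (k`!%:R)^-1 * ('i%C * x%:C) ^+ k =
           cos_coeff x k +i* sin_coeff x k :> R[i].
  rewrite exprMn -rmorphXn /= /cos_coeff /sin_coeff /=.
  have -> : (k`!%:R)^-1 = ((k`!%:R)^-1)%:C :> R[i] by rewrite fmorphV rmorph_nat.
  have -> : 'i%C ^+ k = ((~~ odd k)%:R * (-1) ^+ k./2)
                          +i* ((odd k)%:R * (-1) ^+ k.-1./2) :> R[i].
    rewrite -{1}(odd_double_half k) exprD -muln2 mulnC exprM sqr_i.
    have -> : (-1) ^+ k./2 = ((-1) ^+ k./2)%:C :> R[i].
      by rewrite rmorphXn rmorphN1.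
    case: (boolP (odd k)) => ok /=.
      have -> : k.-1./2 = k./2.
        by move: ok; case: k => // k /=; rewrite uphalf_half; case: (odd k).
      by rewrite expr1; simpc.
    by rewrite expr0; simpc.
  by simpc; rewrite -!exprnP; congr (_ +i* _); ring.
have S m : series (fun k => (k`!%:R)^-1 * ('i%C * x%:C) ^+ k : R[i]^o) m =
           series (cos_coeff x) m +i* series (sin_coeff x) m.
  rewrite /series /=; elim: m => [|m IH]; first by rewrite !big_geq.
  by rewrite !big_nat_recr //= IH E.
have hc : series (cos_coeff x) @ \oo --> cos x.
  by rewrite unlock; exact: is_cvg_series_cos_coeff.
have hs : series (sin_coeff x) @ \oo --> sin x.
  by rewrite unlock; exact: is_cvg_series_sin_coeff.
(* A positive element of [R[i]] is a positive real number. *)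
apply/cvgrPdist_lt => -[e e'] /=; rewrite ltcE /= => /andP[/eqP -> e0].
have e2 : 0 < e / 2 by rewrite divr_gt0.
near=> m; rewrite S /expi.
have n1 : `|cos x - series (cos_coeff x) m| < e / 2.
  by near: m; move/cvgrPdist_lt: hc; apply.
have n2 : `|sin x - series (sin_coeff x) m| < e / 2.
  by near: m; move/cvgrPdist_lt: hs; apply.
set a := cos x - _ in n1; set b := sin x - _ in n2.
have -> : ((cos x +i* sin x)%C : R[i]^o)
            - (series (cos_coeff x) m +i* series (sin_coeff x) m)%C
          = a%:C + 'i%C * b%:C by simpc.
apply: le_lt_trans (ler_normD _ _) _; rewrite normrM.
have -> : `|'i%C| = 1 :> R[i].
  by rewrite normc_def /= expr0n /= add0r expr1n sqrtr1.
have N (r : R) : `|r%:C| = `|r|%:C.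
  by rewrite normc_def /= expr0n /= addr0 sqrtr_sqr.
by rewrite mul1r !N -rmorphD -[e +i* 0]/(e%:C) ltcR [e]splitr ltrD.
Unshelve. all: by end_near.
Qed.

(** * Transition matrices of real symmetric matrices *)

Section Transition.
Variables (R : realType) (n : nat).
Notation toC := (map_mx (real_complex R)).

(** A real symmetric matrix is Hermitian over the complex numbers, hence
    normal, and its eigenvalues are real. *)
Lemma real_symmetric_diagonalizable (M : 'M[R]_n) : M^T = M ->
  exists (P : 'M[R[i]]_n) (r : 'rV[R]_n),
    P \in unitmx /\ toC M = invmx P *m diag_mx (toC r) *m P.
Proof.
move=> symM.
have hM : toC M \is hermsymmx.
  apply/is_hermitianmxP; rewrite expr0 scale1r; apply/matrixP => i j.
  by rewrite -{1}symM !mxE -[RHS]/(conjc _) conjc_real.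
have /mxOverP realD := hermitian_spectral_diag_real hM.
exists (spectralmx (toC M)), (map_mx (@complex.Re R) (spectral_diag (toC M))).
split; first exact: spectral_unit.
suff -> : toC (map_mx (@complex.Re R) (spectral_diag (toC M))) =
          spectral_diag (toC M).
  exact: (orthomx_spectralP (hermitian_normalmx hM)).
by apply/matrixP => i j; rewrite !mxE RRe_real.
Qed.

Lemma transition_diag (M : 'M[R]_n) t (P : 'M[R[i]]_n) (r : 'rV[R]_n) :
  P \in unitmx -> toC M = invmx P *m diag_mx (toC r) *m P ->
  transition M t =
  invmx P *m diag_mx (map_mx (fun x => expi (x * t)) r) *m P.
Proof.
move=> uP DM; rewrite /transition DM.
set d : 'rV[R[i]]_n := map_mx (fun x => 'i%C * (x * t)%:C) r.
rewrite scale_diag_conj.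
have -> : ('i%C * t%:C) *: toC r = d.
  apply/matrixP => i j.
  by rewrite !mxE rmorphM /= [in RHS]mulrCA [LHS]mulrC mulrA.
apply: (@cvg_lim ('M[R[i]]_n : normedModType R[i]) (@norm_hausdorff _ _)).
apply: (@cvg_exp_series_diag R[i]) => // j; rewrite !mxE; exact: cvg_expi.
Qed.

(** Transposing a diagonalisation of [M] gives another diagonalisation of [M],
    with the same eigenvalues. *)
Lemma transition_sym (M : 'M[R]_n) t :
  M^T = M -> (transition M t)^T = transition M t.
Proof.
move=> symM; have [P [r [uP DM]]] := real_symmetric_diagonalizable symM.
have uQ : invmx P^T \in unitmx by rewrite unitmx_inv unitmx_tr.
have DM' : toC M = invmx (invmx P^T) *m diag_mx (toC r) *m invmx P^T.
  by rewrite -{1}symM -map_trmx DM !trmx_mul tr_diag_mx invmxK -trmx_inv mulmxA.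
rewrite {1}(transition_diag t uP DM) (transition_diag t uQ DM').
by rewrite !trmx_mul tr_diag_mx invmxK -trmx_inv mulmxA.
Qed.

Lemma transition_eigenvector (M : 'M[R]_n) t (a : R) (w : 'cV[R]_n) :
  M^T = M -> M *m w = a *: w ->
  transition M t *m toC w = expi (a * t) *: toC w.
Proof.
move=> symM Mw; have [P [r [uP DM]]] := real_symmetric_diagonalizable symM.
rewrite (transition_diag t uP DM) -!mulmxA.
set z := P *m toC w.
have Dz : diag_mx (toC r) *m z = a%:C *: z.
  have := congr1 (mulmx P) (congr1 toC Mw).
  by rewrite map_mxM map_mxZ DM -!mulmxA mulKVmx // -scalemxAr.
suff -> : diag_mx (map_mx (fun x => expi (x * t)) r) *m z = expi (a * t) *: z.
  by rewrite -scalemxAr mulKmx.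
(* In the basis of eigenvectors, [w] is supported on the indices whose
   eigenvalue is [a]. *)
move: z Dz => z Dz; apply/matrixP => i j; have /matrixP/(_ i j) := Dz.
rewrite !mul_diag_mx !mxE.
have [->|z0] := eqVneq (z i j) 0; first by rewrite !mulr0.
by move=> /(mulIf z0) /complexI ->.
Qed.

Lemma transition_eigenvector_dual (M : 'M[R]_n) t (a : R) (w : 'cV[R]_n) :
  M^T = M -> M *m w = a *: w ->
  (toC w)^T *m transition M t = expi (a * t) *: (toC w)^T.
Proof.
move=> symM Mw; apply: trmx_inj; rewrite trmx_mul trmxK transition_sym //.
by rewrite (transition_eigenvector t symM Mw) linearZ /= trmxK.
Qed.

(** Strong cospectrality.  With [z = exp(i a tau) / gamma], every eigenvector
    [w] satisfies [w . v = z (w . u)].  If [z] is real it is a sign; if it is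
    not, both dot products vanish for every [w], and any sign works. *)
Lemma pst_eigenspace_sign (M : 'M[R]_n) (u v : 'cV[R]_n) (a : R) :
  M^T = M -> perfect_state_transfer M u v ->
  exists eps : bool, forall w : 'cV[R]_n, M *m w = a *: w ->
    w^T *m v = (-1) ^+ eps *: (w^T *m u).
Proof.
move=> symM [_ _ _ [tau [gamma [_ g1 Uu]]]].
set z := expi (a * tau) / gamma.
have g0 : gamma != 0 by rewrite -normr_eq0 g1 oner_eq0.
have z1 : `|z| = 1 by rewrite normf_div normr_expi g1 divr1.
have ZE (b : R[i]) (A : 'M[R[i]]_1) : (b *: A) 0 0 = b * A 0 0 by rewrite mxE.
have CE (A : 'M[R]_1) : toC A 0 0 = (A 0 0)%:C by rewrite mxE.
have key (w : 'cV[R]_n) :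
    M *m w = a *: w -> ((w^T *m v) 0 0)%:C = z * ((w^T *m u) 0 0)%:C.
  move=> Mw; have := congr1 (mulmx (toC w)^T) Uu.
  rewrite mulmxA (transition_eigenvector_dual tau symM Mw).
  rewrite -scalemxAl -scalemxAr map_trmx -!map_mxM => /matrixP/(_ 0 0).
  by rewrite !ZE !CE /z mulrAC => ->; rewrite mulrAC divff // mul1r.
have [zr|zr] := eqVneq (complex.Im z) 0.
  have zE : z = (complex.Re z)%:C by rewrite {1}[z]complexE zr mulr0 addr0.
  exists (complex.Re z != 1) => w Mw.
  apply/matrixP => i j; rewrite !ord1 [RHS]mxE.
  apply: complexI; rewrite key // zE -rmorphM /=; congr ((_ * _)%:C).
  move: z1; rewrite zE normc_def /= expr0n /= addr0 sqrtr_sqr => /complexI.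
  case: eqVneq => [-> //|/eqP ne] /eqP.
  by rewrite eqr_norml => /andP[/orP[/eqP//|/eqP ->]].
exists false => w Mw; rewrite scale1r.
have e : (w^T *m u) 0 0 = 0.
  have := congr1 (@complex.Im R) (key w Mw); rewrite [z]complexE /=; simpc => /=.
  by move/esym/eqP; rewrite mulf_eq0 (negPf zr) => /eqP.
apply/matrixP => i j; rewrite !ord1 e; apply: complexI; rewrite key // e.
by rewrite mulr0.
Qed.

End Transition.

(** * Laplacians and pair states of arbitrary graphs *)

Section LaplacianAction.
Variables (R : realType) (G : sgraph).

Definition vcol (f : G -> R) : 'cV[R]_#|G| := \col_i f (enum_val i).

Lemma laplacian_sym : (laplacian R G)^T = laplacian R G.
Proof.
apply/matrixP => i j; rewrite !mxE adj_sym; congr (_ - _).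
by case: eqVneq => [->|ne]; rewrite ?eqxx // eq_sym (negPf ne).
Qed.

Lemma sum_enum_val (f : G -> R) : \sum_(i < #|G|) f (enum_val i) = \sum_x f x.
Proof. by rewrite [RHS](reindex _ (onW_bij _ (enum_val_bij G))). Qed.

Lemma laplacian_vcol (f : G -> R) :
  laplacian R G *m vcol f = vcol (fun x => \sum_(y | adj x y) (f x - f y)).
Proof.
apply/matrixP => i j; rewrite mulmxBl mul_diag_mx !mxE sumrB; congr (_ - _).
  rewrite sumr_const mulr_natl; congr (_ *+ _).
  by apply: eq_card => y; rewrite inE.
under eq_bigr do rewrite !mxE.
rewrite (sum_enum_val (fun y => (adj (enum_val i) y)%:R * f y)).
rewrite [RHS]big_mkcond.
by apply: eq_bigr => y _; case: adj; rewrite (mul1r, mul0r).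
Qed.

Lemma pair_state_vcol (x y : G) :
  pair_state R x y =
  (Num.sqrt 2)^-1 *: vcol (fun p => (p == x)%:R - (p == y)%:R).
Proof.
congr (_ *: _); apply/matrixP => i j; rewrite !mxE ord1 eqxx !andbT.
by rewrite -!(inj_eq enum_val_inj) !enum_rankK.
Qed.

Lemma invsqrt2_neq0 : (Num.sqrt 2 : R)^-1 != 0.
Proof. by rewrite invr_eq0 sqrtr_eq0 -ltNge. Qed.

Lemma dot_pair_state (f : G -> R) (x y : G) :
  ((vcol f)^T *m pair_state R x y) 0 0 = (Num.sqrt 2)^-1 * (f x - f y).
Proof.
rewrite pair_state_vcol -scalemxAr mxE; congr (_ * _).
rewrite mxE; under eq_bigr do rewrite !mxE.
rewrite (sum_enum_val (fun p => f p * ((p == x)%:R - (p == y)%:R))).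
under eq_bigr do rewrite mulrBr; rewrite sumrB.
rewrite (bigD1 x) //= eqxx mulr1 big1 => [|p /negPf->]; last by rewrite mulr0.
rewrite (bigD1 y) //= eqxx mulr1 big1 => [|p /negPf->]; last by rewrite mulr0.
by rewrite !addr0.
Qed.

Lemma pair_state_unit (x y : G) : x != y -> unit_vector (pair_state R x y).
Proof.
move=> xy; have yx : y != x by rewrite eq_sym.
rewrite /unit_vector pair_state_vcol; under eq_bigr do rewrite !mxE.
rewrite (sum_enum_val
  (fun p => ((Num.sqrt 2)^-1 * ((p == x)%:R - (p == y)%:R)) ^+ 2)).
under eq_bigr do rewrite exprMn exprVn sqr_sqrtr //.
rewrite -mulr_sumr (bigD1 x) //= eqxx (negPf xy) subr0 expr1n.
rewrite (bigD1 y) //= eqxx (negPf yx) sub0r sqrrN expr1n.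
rewrite big1 => [|p /andP[/negPf-> /negPf->]]; last by rewrite subrr expr0n.
by rewrite addr0 mulVf // pnatr_eq0.
Qed.

Lemma pair_states_free (x y z w : G) :
  x != y -> z != w -> x != z -> x != w ->
  free [:: pair_state R x y; pair_state R z w].
Proof.
move=> xy zw xz xw.
have pE (a b p : G) : pair_state R a b (enum_rank p) 0 =
                (Num.sqrt 2)^-1 * ((p == a)%:R - (p == b)%:R).
  by rewrite pair_state_vcol !mxE enum_rankK.
rewrite free_cons seq1_free span_seq1; apply/andP; split.
  apply/negP => /vlineP [c] /matrixP/(_ (enum_rank x) 0)/eqP.
  rewrite [in X in _ == X]mxE !pE eqxx (negPf xy) (negPf xz) (negPf xw).
  by rewrite !subr0 mulr1 !mulr0 (negPf invsqrt2_neq0).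
apply/negP => /eqP/matrixP/(_ (enum_rank z) 0)/eqP.
by rewrite pE mxE eqxx (negPf zw) subr0 mulr1 (negPf invsqrt2_neq0).
Qed.

(** Pair states without the factor [1 / sqrt 2], over the integers, where the
    irrationality argument takes place. *)
Definition pairz (x y p : G) : int := (p == x)%:R - (p == y)%:R.

Lemma sum_pairz (x y : G) : \sum_p pairz x y p = 0.
Proof.
have D (z : G) : \sum_p (p == z)%:R = 1 :> int.
  by rewrite (bigD1 z) //= eqxx big1 ?addr0 // => p /negPf->.
by rewrite sumrB !D subrr.
Qed.

Lemma pair_state_sign_not_free (x y z w : G) (eps : bool) :
  (forall p, pairz z w p = (-1) ^+ eps * pairz x y p) ->
  ~~ free [:: pair_state R x y; pair_state R z w].
Proof.
move=> e.
have -> : pair_state R z w = (-1) ^+ eps *: pair_state R x y.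
  rewrite !pair_state_vcol scalerA mulrC -scalerA; congr (_ *: _).
  apply/matrixP => i j; rewrite !mxE.
  have := congr1 (fun m : int => m%:~R : R) (e (enum_val i)).
  by rewrite /pairz !(rmorphB, rmorphM, rmorphXn, rmorphN1) /= !rmorph_nat.
rewrite free_cons negb_and negbK; apply/orP; left.
rewrite span_seq1; apply/vlineP; exists ((-1) ^+ eps).
by rewrite scalerA -expr2 sqrr_sign scale1r.
Qed.

End LaplacianAction.

(** * Eigenvectors of the complementary prism of a complete graph *)

Section Prism.
Variables (R : realType) (n : nat).
Notation KK := (cprism (complete n)).

Definition layered (f g : 'I_n -> R) (p : KK) : R :=
  match p with inl a => f a | inr a => g a end.

Lemma laplacian_layered (f g : 'I_n -> R) :
  laplacian R KK *m vcol (layered f g) =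
  vcol (layered (fun a => n.+1%:R * f a - \sum_b f b - g a)
                (fun a => g a - f a)).
Proof.
rewrite laplacian_vcol; congr vcol.
apply/funext => -[] a /=; rewrite big_sumType /=.
  rewrite [X in _ + X](big_pred1 a) => [|b]; last by rewrite eq_sym.
  have -> : \sum_(b | a != b) (f a - f b) = \sum_b (f a - f b).
    rewrite [RHS](bigD1 a) //= subrr add0r.
    by apply: eq_bigl => b; rewrite eq_sym.
  by rewrite sumrB sumr_const card_ord -[f a *+ n]mulr_natl -natr1; ring.
rewrite [X in X + _](big_pred1 a) => [|b]; last by rewrite eq_sym.
by rewrite big_pred0 ?addr0 // => b; rewrite /compl_adj /=; case: (_ == _).
Qed.

Lemma eigen_const :
  laplacian R KK *m vcol (layered (fun=> 1) (fun=> -1)) =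
  2 *: vcol (layered (fun=> 1) (fun=> -1)).
Proof.
rewrite laplacian_layered sumr_const card_ord.
apply/matrixP => i j; rewrite !mxE /layered.
by case: enum_val => a; rewrite -?natr1; ring.
Qed.

(** On functions with sum 0 the Laplacian acts on the two layers by the matrix
    with rows [(n+1, -1)] and [(-1, 1)]; the equation for [k] says that
    [(1, k)] is an eigenvector of it. *)
Lemma eigen_zero_sum (h : 'I_n -> R) (k : R) : \sum_a h a = 0 ->
  k ^+ 2 = n%:R * k + 1 ->
  laplacian R KK *m vcol (layered h (fun a => k * h a)) =
  (n.+1%:R - k) *: vcol (layered h (fun a => k * h a)).
Proof.
move=> h0 hk; rewrite laplacian_layered h0; apply/matrixP => i j; rewrite !mxE.
rewrite /layered; case: enum_val => a; rewrite -?natr1; first by ring.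
have -> : (n%:R + 1 - k) * (k * h a) =
          (n%:R * k + 1 - k ^+ 2) * h a + (k - 1) * h a by ring.
by rewrite hk; ring.
Qed.

End Prism.

(** * Irrationality of the eigenvalues *)

(** For [b != 0] the equation makes [n^2 + 4] the square of the integer
    [a / b], which is impossible between [n^2] and [(n+2)^2]: the only candidate
    [(n+1)^2] would give [2 n = 3]. *)
Lemma sqr_add4_nonsquare (n : nat) (a b : int) : (0 < n)%N ->
  a ^+ 2 = (n ^ 2 + 4)%:Z * b ^+ 2 -> b = 0.
Proof.
move=> n0 e; apply/eqP; case: eqVneq => // b0; exfalso.
have {}e : (`|a| ^ 2 = (n ^ 2 + 4) * `|b| ^ 2)%N.
  by rewrite -!abszX e abszM.
have b1 : (0 < `|b|)%N by rewrite absz_gt0.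
have /dvdnP [c ac] : (`|b| %| `|a|)%N.
  by rewrite -(dvdn_pexp2r _ _ (isT : 0 < 2)%N) e dvdn_mull.
have c2 : (c ^ 2 = n ^ 2 + 4)%N.
  apply/eqP; rewrite -(eqn_pmul2r (_ : 0 < `|b| ^ 2)%N) ?expn_gt0 ?b1 //.
  by rewrite -expnMn -ac e.
have [cn|cn] := leqP c n.+1.
  have [c'|c'] := leqP c n; nia.
nia.
Qed.

Definition kappa (R : realType) (n : nat) : R :=
  (n%:R + Num.sqrt (n ^ 2 + 4)%:R) / 2.

Lemma kappa_sqr (R : realType) n : kappa R n ^+ 2 = n%:R * kappa R n + 1.
Proof.
have := @sqr_sqrtr R (n ^ 2 + 4)%:R (ler0n _ _).
rewrite /kappa; set s := Num.sqrt _ => s2.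
have -> : ((n%:R + s) / 2) ^+ 2 = (n%:R ^+ 2 + 2 * n%:R * s + s ^+ 2) / 4.
  by field.
by rewrite s2 natrD natrX; field.
Qed.

Lemma kappa_irrational (R : realType) n (a b : int) : (0 < n)%N ->
  a%:~R + kappa R n * b%:~R = 0 -> a = 0 /\ b = 0.
Proof.
move=> n0 ab0.
suff b0 : b = 0.
  split=> //; move: ab0.
  by rewrite b0 mulr0 addr0 => /eqP; rewrite intr_eq0 => /eqP.
(* The relation reads [2 a + n b = - b sqrt (n^2 + 4)]. *)
apply: (@sqr_add4_nonsquare n (2 * a + n%:Z * b)) => //.
apply: (@intr_inj R); rewrite !(rmorphXn, rmorphM, rmorphD) /=.
have hs := @sqr_sqrtr R (n ^ 2 + 4)%:R (ler0n _ _).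
have -> : 2%:~R * a%:~R + n%:~R * b%:~R =
          - Num.sqrt (n ^ 2 + 4)%:R * b%:~R :> R.
  apply/eqP; rewrite -subr_eq0; apply/eqP.
  transitivity (2 * (a%:~R + kappa R n * b%:~R)); last by rewrite ab0 mulr0.
  by rewrite /kappa; field.
by rewrite exprMn sqrrN hs natrD natrX expr2.
Qed.

(** * Absence of transfer for orders other than two *)

Section Rigidity.
Variables (R : realType) (n : nat).
Notation KK := (cprism (complete n)).

(** The eigenvalue [n + 1 - kappa] suffices: its eigenvectors built from
    [h = e_i - e_j] compare the entries of [g] at [i] and [j] in both layers at
    once, and irrationality of [kappa] separates the two layers. *)
Lemma pst_layers (x y z w : KK) : (0 < n)%N ->
  perfect_state_transfer (laplacian R KK)
    (pair_state R x y) (pair_state R z w) ->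
  exists eps : bool,
    let g p := pairz z w p - (-1) ^+ eps * pairz x y p in
    forall i j : 'I_n, g (inl i) = g (inl j) /\ g (inr i) = g (inr j).
Proof.
move=> n0 pst.
have [eps sgn] :=
  pst_eigenspace_sign (n.+1%:R - kappa R n) (laplacian_sym R KK) pst.
exists eps => g i j.
pose h (a : 'I_n) : R := (a == i)%:R - (a == j)%:R.
have D (b : 'I_n) : \sum_a (a == b)%:R = 1 :> R.
  by rewrite (bigD1 b) //= eqxx big1 ?addr0 // => p /negPf->.
have h0 : \sum_a h a = 0 by rewrite sumrB !D subrr.
have /matrixP/(_ 0 0) := sgn _ (eigen_zero_sum h0 (kappa_sqr R n)).
rewrite [RHS]mxE !dot_pair_state mulrCA => /(mulfI (invsqrt2_neq0 R)).
set W := layered _ _.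
have WE (p : KK) : W p = ((inl i == p)%:R - (inl j == p)%:R : int)%:~R
    + kappa R n * ((inr i == p)%:R - (inr j == p)%:R : int)%:~R.
  rewrite !rmorphB /= !rmorph_nat /W /layered /h.
  have ll (b c : 'I_n) : ((inl b : KK) == inl c) = (b == c) by [].
  have rr (b c : 'I_n) : ((inr b : KK) == inr c) = (b == c) by [].
  have lr (b c : 'I_n) : ((inl b : KK) == inr c) = false by [].
  have rl (b c : 'I_n) : ((inr b : KK) == inl c) = false by [].
  case: p => a; rewrite ?ll ?rr ?lr ?rl ![a == _]eq_sym.
    by rewrite subrr mulr0 addr0.
  by rewrite subrr add0r.
move=> WW.
suff [/subr0_eq gl /subr0_eq gr] :
  g (inl i) - g (inl j) = 0 /\ g (inr i) - g (inr j) = 0 by [].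
apply: (@kappa_irrational R n) => //.
rewrite /g /pairz !(rmorphB, rmorphM, rmorphXn, rmorphN1) /= !rmorph_nat.
move: WW; rewrite !WE !(rmorphB) /= !rmorph_nat => WW.
move/eqP: WW; rewrite -subr_eq0 => /eqP WW.
by rewrite -[RHS]WW; ring.
Qed.

Lemma exists_vertex_avoiding (s : seq KK) :
  (size s < n.*2)%N -> exists p, p \notin s.
Proof.
move=> sn; apply/existsP; rewrite -negb_forall; apply/negP => /forallP all_s.
have : (#|KK| <= size s)%N.
  apply: leq_trans (card_size s).
  by apply/subset_leq_card/fintype.subsetP => p _; exact: all_s.
by rewrite card_sum card_ord addnn leqNgt sn.
Qed.

Lemma no_pst_order_ge3 (x y z w : KK) : (2 < n)%N ->
  ~ perfect_state_transfer (laplacian R KK)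
      (pair_state R x y) (pair_state R z w).
Proof.
move=> n3 pst; have n0 : (0 < n)%N by lia.
have [eps] := pst_layers n0 pst; set g := (fun p => _) => /= glr.
case: (pst) => _ _ /negP fr _; case: fr; apply/negP.
apply: (@pair_state_sign_not_free _ _ _ _ _ _ eps) => p.
apply/subr0_eq; rewrite -/(g p).
have sum_g : \sum_p g p = 0.
  by rewrite sumrB -mulr_sumr !sum_pairz mulr0 subrr.
have [t] := @exists_vertex_avoiding [:: x; y; z; w] (ltac:(simpl; lia)).
rewrite !inE !negb_or => /and4P[/negPf tx /negPf ty /negPf tz /negPf tw].
have gt : g t = 0 by rewrite /g /pairz tx ty tz tw subrr mulr0 subrr.
pose i0 := Ordinal n0.
have gl i : g (inl i) = g (inl i0) by case: (glr i i0).
have gr i : g (inr i) = g (inr i0) by case: (glr i i0).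
have : (g (inl i0) + g (inr i0)) *+ n = 0.
  rewrite -sum_g big_sumType /=.
  rewrite (eq_bigr _ (fun i _ => gl i)) (eq_bigr _ (fun i _ => gr i)).
  by rewrite !sumr_const card_ord mulrnDl.
move/eqP; rewrite mulrn_eq0 eqn0Ngt n0 /= => /eqP glr0.
have [gl0 gr0] : g (inl i0) = 0 /\ g (inr i0) = 0.
  case: t gt {tx ty tz tw} => a; rewrite ?gl ?gr => e; move: glr0;
  by rewrite e ?addr0 ?add0r.
by case: p => a; rewrite ?gl ?gr.
Qed.

End Rigidity.

Lemma no_pst_order1 (R : realType) (x y z w : cprism (complete 1)) :
  x != y -> z != w ->
  ~ perfect_state_transfer (laplacian R (cprism (complete 1)))
      (pair_state R x y) (pair_state R z w).
Proof.
move=> xy zw [_ _ /negP fr _]; case: fr; apply/negP.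
apply: (@pair_state_sign_not_free _ _ _ _ _ _ (x != z)) => p.
by case: x y z w p xy zw => a [] b [] c [] d [] p; rewrite !ord1.
Qed.

(** * Transfer between the end edges of the path with four vertices *)

Lemma pst_order2 (R : realType) :
  perfect_pair_state_transfer (laplacian R (cprism (complete 2))).
Proof.
pose o0 : 'I_2 := ord0; pose o1 : 'I_2 := ord_max.
pose KK := cprism (complete 2); pose L := laplacian R KK.
exists (inl o0 : KK), (inr o0 : KK), (inl o1 : KK), (inr o1 : KK).
split=> //; split;
  [exact: pair_state_unit|exact: pair_state_unit|exact: pair_states_free|].
set s : R := Num.sqrt 2.
have s2 : s ^+ 2 = 2 by rewrite sqr_sqrtr.
have s0 : 0 < s by rewrite sqrtr_gt0.
exists (pi / s), (expi (2 * (pi / s))).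
split; [by rewrite divr_gt0 ?pi_gt0|exact: normr_expi|].
pose h (a : 'I_2) : R := (-1) ^+ a.
have h0 : \sum_a h a = 0.
  by rewrite big_ord_recl big_ord1 /h /= expr0 expr1 subrr.
pose W k := vcol (layered h (fun a => k * h a)) : 'cV[R]_#|KK|.
pose W0 := vcol (layered (fun=> 1) (fun=> -1)) : 'cV[R]_#|KK|.
have symL : L^T = L := laplacian_sym R KK.
have U0 := transition_eigenvector (pi / s) symL (eigen_const R 2).
have expi_pi : expi pi = -1 :> R[i] by rewrite /expi cospi sinpi; simpc.
have expi_Npi : expi (- pi) = -1 :> R[i].
  by rewrite /expi cosN sinN cospi sinpi oppr0; simpc.
(* [1 - s] and [1 + s] are the roots of [k^2 = 2 k + 1]; the corresponding
   eigenvalues [3 - k] are [2 + s] and [2 - s], and [s * (pi / s) = pi]. *)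
have Up : transition L (pi / s) *m map_mx (real_complex R) (W (1 - s)) =
    - expi (2 * (pi / s)) *: map_mx (real_complex R) (W (1 - s)).
  have hk : (1 - s) ^+ 2 = 2%:R * (1 - s) + 1 by rewrite sqrrB s2; ring.
  rewrite (transition_eigenvector _ symL (eigen_zero_sum h0 hk)).
  have -> : (3%:R - (1 - s)) * (pi / s) = 2 * (pi / s) + pi.
    by field; rewrite gt_eqF.
  by rewrite expiD expi_pi mulrN1.
have Um : transition L (pi / s) *m map_mx (real_complex R) (W (1 + s)) =
    - expi (2 * (pi / s)) *: map_mx (real_complex R) (W (1 + s)).
  have hk : (1 + s) ^+ 2 = 2%:R * (1 + s) + 1 by rewrite sqrrD s2; ring.
  rewrite (transition_eigenvector _ symL (eigen_zero_sum h0 hk)).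
  have -> : (3%:R - (1 + s)) * (pi / s) = 2 * (pi / s) - pi.
    by field; rewrite gt_eqF.
  by rewrite expiD expi_Npi mulrN1.
(* The coefficients solve [al + be = 1] and
   [al (1 - s) + be (1 + s) = -1], so that [D] is [(h, - h)]. *)
pose D := (1 + s) / 2 *: W (1 - s) + (1 - s) / 2 *: W (1 + s).
have UD : transition L (pi / s) *m map_mx (real_complex R) D =
    - expi (2 * (pi / s)) *: map_mx (real_complex R) D.
  rewrite map_mxD !map_mxZ mulmxDr -!scalemxAr Up Um scalerDr !scalerA.
  by rewrite ![_ * - _]mulrC.
have DE : D = vcol (layered h (fun a => - h a)).
  apply/matrixP => i j; rewrite !mxE /layered.
  case: enum_val => a; first by field.
  transitivity ((1 - s ^+ 2) * h a); first by field.
  by rewrite s2; ring.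
have uE : pair_state R (inl o0 : KK) (inr o0) = s^-1 / 2 *: (W0 + D).
  rewrite pair_state_vcol -scalerA DE; congr (_ *: _).
  apply/matrixP => i j; rewrite !mxE.
  by case: enum_val => -[[|[|//]] ?]; rewrite /h /=; field.
have vE : pair_state R (inl o1 : KK) (inr o1) = s^-1 / 2 *: (W0 - D).
  rewrite pair_state_vcol -scalerA DE; congr (_ *: _).
  apply/matrixP => i j; rewrite !mxE.
  by case: enum_val => -[[|[|//]] ?]; rewrite /h /=; field.
rewrite uE vE !map_mxZ -scalemxAr map_mxD map_mxB mulmxDr U0 UD.
by rewrite scaleNr -scalerBr !scalerA mulrC.
Qed.

(** * Characterisation of the order *)

Local Close Scope complex_scope.
Local Close Scope classical_set_scope.
Local Close Scope ring_scope.

Theorem theorem11 (R : realType) (n : nat) :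
  perfect_pair_state_transfer (laplacian R (cprism (complete n))) <-> n = 2.
Proof.
split=> [[x [y [z [w [xy zw pst]]]]]|->]; last exact: pst_order2.
case: n x y z w xy zw pst => [|[|[//|n]]] x y z w xy zw pst.
- by case: x {xy pst} => -[].
- by case: (no_pst_order1 xy zw pst).
- by case: (no_pst_order_ge3 (isT : 2 < n.+3) pst).
Qed.
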